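(* Let $X: g=0$ be a reduced hypersurface of degree $d$ in $\mathbb{C}^n$, with $g\in R=\mathbb{C}[x_1,\ldots,x_n]$, and let $D: f=0$ be its closure in $\mathbb{P}^n$, where $f\in S=\mathbb{C}[x_0,x_1,\ldots,x_n]$ is the degree $d$ homogenization of $g$. Then there is a surjective morphism of $S$-modules $\phi: AR(f)\to AR(g)$, given by $$\phi(a_0,a_1,\ldots,a_n)=\bigl(d\cdot\theta(a_0),\ \theta(a_1)-x_1\theta(a_0),\ \ldots,\ \theta(a_n)-x_n\theta(a_0)\bigr)$$ for any $(a_0,a_1,\ldots,a_n)\in AR(f)$.
   Context: $R=\mathbb{C}[x_1,\ldots,x_n]$, $S=\mathbb{C}[x_0,x_1,\ldots,x_n]$. The polynomial $g\in R$ is nonconstant and reduced (square-free) of degree $d$, and $f(x_0,\ldots,x_n)=x_0^d\, g(x_1/x_0,\ldots,x_n/x_0)\in S$, so that $g=f(1,x_1,\ldots,x_n)$ and $x_0\nmid f$. Write $g_j=\partial g/\partial x_j$ ($1\le j\le n$) and $f_j=\partial f/\partial x_j$ ($0\le j\le n$). Define $$AR(g)=\{(\alpha_0,\ldots,\alpha_n)\in R^{n+1} : \alpha_0 g+\alpha_1g_1+\cdots+\alpha_ng_n=0\},$$ $$AR(f)=\{(a_0,\ldots,a_n)\in S^{n+1} : a_0f_0+a_1f_1+\cdots+a_nf_n=0\}.$$ The ring morphism $\theta:S\to R$ is $\theta(u)=u(1,x_1,\ldots,x_n)$; every $R$-module, in particular $AR(g)$, is regarded as an $S$-module via $\theta$.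 *)

(* Defs.v *)
From HB Require Import structures.
From mathcomp Require Import all_boot all_order all_algebra.
From mathcomp Require Import reals.
From mathcomp Require Import complex.
From mathcomp Require Import mpoly.

Set Implicit Arguments.
Unset Strict Implicit.
Unset Printing Implicit Defensive.

Import GRing.Theory.
Local Open Scope ring_scope.

Section Syzygies.
Variables (A : comNzRingType) (m : nat).
Implicit Types w a : 'rV[A]_m.

Definition is_syzygy w : {pred 'rV[A]_m} :=
  fun a => \sum_(j < m) a 0 j * w 0 j == 0.

Lemma is_syzygy_submod w : submod_closed (is_syzygy w).
Proof.
split=> [|c a b /eqP ha /eqP hb]; rewrite unfold_in.
  by rewrite big1 // => j _; rewrite mxE mul0r.
under eq_bigr => j _ do rewrite !mxE mulrDl -mulrA.
by rewrite big_split /= -mulr_sumr ha hb mulr0 addr0.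
Qed.

HB.instance Definition _ w :=
  GRing.isSubmodClosed.Build A 'rV[A]_m (is_syzygy w) (is_syzygy_submod w).

Record syzygy w := Syzygy {
  syzygy_val :> 'rV[A]_m;
  syzygy_valP : syzygy_val \in is_syzygy w }.

HB.instance Definition _ w := [isSub of syzygy w for @syzygy_val w].
HB.instance Definition _ w := [Choice of syzygy w by <:].
HB.instance Definition _ w := [SubChoice_isSubZmodule of syzygy w by <:].
HB.instance Definition _ w := [SubZmodule_isSubLmodule of syzygy w by <:].

End Syzygies.

(* The B-module M regarded as an A-module via nu : A -> B, as a type alias. *)
Definition restrict_scalars (A B : nzRingType) (nu : {rmorphism A -> B})
  (M : lmodType B) : Type := M.

Section RestrictScalars.
Variables (A B : nzRingType) (nu : {rmorphism A -> B}) (M : lmodType B).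

HB.instance Definition _ := GRing.Zmodule.on (restrict_scalars nu M).

Definition restrict_scale (a : A) (v : restrict_scalars nu M) :
  restrict_scalars nu M := nu a *: (v : M).

Fact restrict_scaleA a b v :
  restrict_scale a (restrict_scale b v) = restrict_scale (a * b) v.
Proof. by rewrite /restrict_scale scalerA rmorphM. Qed.

Fact restrict_scale1 : left_id 1 restrict_scale.
Proof. by move=> v; rewrite /restrict_scale rmorph1 scale1r. Qed.

Fact restrict_scaleDr : right_distributive restrict_scale +%R.
Proof. by move=> a u v; apply: scalerDr. Qed.

Fact restrict_scaleDl v : {morph restrict_scale^~ v : a b / a + b}.
Proof. by move=> a b; rewrite /restrict_scale rmorphD; apply: scalerDl. Qed.

HB.instance Definition _ := GRing.Zmodule_isLmodule.Build A
  (restrict_scalars nu M)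
  restrict_scaleA restrict_scale1 restrict_scaleDr restrict_scaleDl.

End RestrictScalars.

(* Throughout, the variables x_0, ..., x_n of a polynomial in n.+1 variables
   are indexed by 'I_n.+1, the affine variables x_1, ..., x_n being
   'X_(lift ord0 i) for i : 'I_n; in n variables, x_(i+1) is 'X_i. *)
Section Homogenization.
Variables (K : fieldType) (n : nat).
Local Notation Raff := {mpoly K[n]}.
Local Notation Sproj := {mpoly K[n.+1]}.

Definition squarefree_mpoly (g : Raff) : Prop :=
  forall q r : Raff, g = q ^+ 2 * r -> q \is a GRing.unit.

(* f = x_0 ^ d * g(x_1 / x_0, ..., x_n / x_0), in the fraction field of
   K[x_0, ..., x_n]. *)
Definition is_homogenization (d : nat) (g : Raff) (f : Sproj) : Prop :=
  tofrac f =
    tofrac 'X_ord0 ^+ d *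
    mmap (fun c : K => tofrac (c%:MP : Sproj))
         (fun i : 'I_n => tofrac ('X_(lift ord0 i) : Sproj) / tofrac 'X_ord0) g.

Definition homogenize (d : nat) (g : Raff) : Sproj :=
  \sum_(m <- msupp g)
    g@_m *: ('X_ord0 ^+ (d - mdeg m) * \prod_(i < n) 'X_(lift ord0 i) ^+ m i).

Lemma is_homogenizationP d g f :
  (msize g <= d.+1)%N -> is_homogenization d g f <-> f = homogenize d g.
Proof.
move=> gd; set F0 := tofrac ('X_ord0 : Sproj).
have F0_neq0 : F0 != 0.
  by rewrite tofrac_eq0 -msize_poly_eq0 msizeX mdeg1.
suff hE : is_homogenization d g (homogenize d g).
  by split=> [fE|->//]; apply/eqP; rewrite -tofrac_eq fE hE.
rewrite /is_homogenization -/F0 /homogenize /mmap mulr_sumr rmorph_sum /=.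
apply: eq_big_seq => m /msize_mdeg_lt m_lt; rewrite -mul_mpolyC.
have md : (mdeg m <= d)%N by rewrite -ltnS (leq_trans m_lt).
rewrite !rmorphM rmorph_prod rmorphXn /= -/F0 [RHS]mulrCA; congr (_ * _).
rewrite /mmap1; under [in RHS]eq_bigr do rewrite expr_div_n.
rewrite prodf_div -expr_sum -mdegE -[in RHS](subnK md) exprD.
rewrite -mulrA [F0 ^+ mdeg m * _]mulrC divfK ?expf_neq0 //.
by congr (_ * _); apply: eq_bigr => i _; rewrite rmorphXn.
Qed.

Definition theta : {rmorphism Sproj -> Raff} :=
  comp_mpoly [tuple if unlift ord0 j is Some i then 'X_i else 1 | j < n.+1].

Definition AR_proj (f : Sproj) := syzygy (\row_(j < n.+1) f^`M(j)).

Definition AR_aff (g : Raff) :=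
  syzygy (\row_(j < n.+1) if unlift ord0 j is Some i then g^`M(i) else g).

End Homogenization.
Arguments theta {K n}.

(* Main.v *)
(** Dehomogenizing Euler's identity [\sum_j x_j f_j = d f] gives
    [theta f_0 = d g - \sum_i x_i g_i], while [theta f_i = g_i] for [i >= 1];
    hence [theta (\sum_j a_j f_j)] is the combination of [g, g_1, ..., g_n] with
    coefficients [phi a]. So [phi] sends syzygies to syzygies. For surjectivity,
    solve [phi a = alpha] for the dehomogenized [a_j] (dividing by [d]) and
    homogenize the solutions to a common degree: then [\sum_j a_j f_j] is
    homogeneous with zero image under [theta], and [theta] is injective on
    homogeneous polynomials of a fixed degree. *)
From HB Require Import structures.
Require Import Defs.
From mathcomp Require Import all_boot all_order all_algebra.
From mathcomp Require Import reals.
From mathcomp Require Import complex.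
From mathcomp Require Import mpoly.

Set Implicit Arguments.
Unset Strict Implicit.
Unset Printing Implicit Defensive.

Import GRing.Theory.
Local Open Scope ring_scope.

Section HomogeneousPolynomials.
Variables (A : comNzRingType) (n : nat).
Implicit Types (p : {mpoly A[n]}) (d : nat).

(** A monomial [m] of the derivative comes from [m + U_(i)], of degree one more. For [d = 0] there
    is no such monomial, so the truncation in [d.-1] does no harm. *)
Lemma dhomog_mderiv d p i :
  p \is d.-homog -> p^`M(i) \is d.-1.-homog.
Proof.
move=> /dhomogP hp; apply/dhomogP => m.
rewrite mcoeff_msupp mcoeff_mderiv => m_supp.
have /hp <- : (m + U_(i))%MM \in msupp p.
  by rewrite mcoeff_msupp; apply: contraNneq m_supp => ->; rewrite mul0rn.
by rewrite /= mdegD mdeg1 addn1.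
Qed.

Lemma dhomog_euler d p :
  p \is d.-homog -> \sum_(i < n) 'X_i * p^`M(i) = p *+ d.
Proof.
move=> /dhomogP hp; rewrite (mpolyE p) -sumrMnl.
under eq_bigr => i _ do rewrite raddf_sum mulr_sumr.
rewrite exchange_big; apply: eq_big_seq => m /hp mE /=.
rewrite -[in RHS]mE /= mdegE -sumrMnr; apply: eq_bigr => i _.
rewrite mderivZ mderivX -scalerAr scalerMnr; congr (_ *: _).
(* Subtraction of exponents truncates, so [m - U_(i) + U_(i)] gives back [m] only if [m i] is
   nonzero; otherwise both coefficients vanish. *)
have [->|mi_neq0] := eqVneq (m i) 0%N; first by rewrite scale0r mulr0 mulr0n.
by rewrite -scalerAr -mpolyXD addmC submK ?lep1mP // scaler_nat.
Qed.

End HomogeneousPolynomials.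

Section Dehomogenization.
Variables (K : fieldType) (n : nat).
Implicit Types (g : {mpoly K[n]}) (p : {mpoly K[n.+1]}) (d : nat).

Definition mnm_tail (m : 'X_{1..n.+1}) : 'X_{1..n} :=
  [multinom m (lift ord0 i) | i < n].

Lemma mdeg_mnm_tail m : mdeg m = (m ord0 + mdeg (mnm_tail m))%N.
Proof.
rewrite !mdegE big_ord_recl; congr (_ + _)%N.
by apply: eq_bigr => i _; rewrite mnmE.
Qed.

(** The total degree recovers the exponent of [x_0], the only one that [mnm_tail] forgets. *)
Lemma mnm_tail_inj m1 m2 :
  mdeg m1 = mdeg m2 -> mnm_tail m1 = mnm_tail m2 -> m1 = m2.
Proof.
move=> degE tailE; have m0E : m1 ord0 = m2 ord0.
  apply/eqP; rewrite -(eqn_add2r (mdeg (mnm_tail m2))) -{1}tailE.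
  by rewrite -!mdeg_mnm_tail degE.
apply/mnmP => j; case: (unliftP ord0 j) => [i ->|->//].
by have /mnmP/(_ i) := tailE; rewrite !mnmE.
Qed.

Lemma theta_X m : theta 'X_[K, m] = 'X_[mnm_tail m].
Proof.
rewrite /= comp_mpolyX big_ord_recl tnth_mktuple unlift_none expr1n mul1r.
rewrite mpolyXE_id; apply: eq_bigr => i _.
by rewrite tnth_mktuple liftK mnmE.
Qed.

Lemma thetaZ c p : theta (c *: p) = c *: theta p.
Proof. exact: comp_mpolyZ. Qed.

Lemma thetaE p : theta p = \sum_(m <- msupp p) p@_m *: 'X_[mnm_tail m].
Proof.
rewrite [in LHS](mpolyE p) rmorph_sum; apply: eq_bigr => m _.
by rewrite thetaZ theta_X.
Qed.

Lemma theta_mderiv p i : theta p^`M(lift ord0 i) = (theta p)^`M(i).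
Proof.
rewrite [in RHS]thetaE [in LHS](mpolyE p).
rewrite !(big_morph (mderiv _) (mderivD _) (mderiv0 _ _)) rmorph_sum.
apply: eq_bigr => m _.
rewrite !mderivZ !mderivX !thetaZ theta_X mnmE; congr (_ *: (_ *: 'X_[_])).
by apply/mnmP => k; rewrite !mnmE; congr (_ - nat_of_bool _)%N.
Qed.

(** Monomials of equal degree keep distinct tails, so nothing cancels under [theta]: the coefficient
    of [theta p] at [mnm_tail m] is that of [p] at [m]. *)
Lemma dhomog_theta_eq0 d p : p \is d.-homog -> theta p = 0 -> p = 0.
Proof.
move=> /dhomogP hp; rewrite thetaE => tp0; apply/mpolyP => m; rewrite mcoeff0.
apply: contra_eq tp0 => pm_neq0; have m_supp : m \in msupp p.
  by rewrite mcoeff_msupp.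
apply: contraNneq pm_neq0 => /(congr1 (mcoeff (mnm_tail m))).
rewrite mcoeff0 raddf_sum (bigD1_seq m) ?msupp_uniq //=.
rewrite mcoeffZ mcoeffX eqxx mulr1 big_seq_cond big1 ?addr0 => [->//|].
move=> m' /andP[m'_supp m'm]; rewrite mcoeffZ mcoeffX.
case: eqP => [tailE|]; last by rewrite mulr0.
by case/eqP: m'm; apply: mnm_tail_inj tailE; rewrite !hp.
Qed.

Definition mnm_cons (k : nat) (m : 'X_{1..n}) : 'X_{1..n.+1} :=
  [multinom if unlift ord0 j is Some i then m i else k | j < n.+1].

Lemma mnm_consK k m : mnm_tail (mnm_cons k m) = m.
Proof. by apply/mnmP => i; rewrite !mnmE liftK. Qed.

Lemma mdeg_mnm_cons k m : mdeg (mnm_cons k m) = (k + mdeg m)%N.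
Proof. by rewrite mdeg_mnm_tail mnm_consK mnmE unlift_none. Qed.

Lemma homogenizeE d g :
  homogenize d g = \sum_(m <- msupp g) g@_m *: 'X_[mnm_cons (d - mdeg m) m].
Proof.
apply: eq_bigr => m _; rewrite [in RHS]mpolyXE_id big_ord_recl mnmE unlift_none.
by congr (_ *: (_ * _)); apply: eq_bigr => i _; rewrite mnmE liftK.
Qed.

Lemma homogenizeK d g : theta (homogenize d g) = g.
Proof.
rewrite homogenizeE rmorph_sum [RHS]mpolyE; apply: eq_bigr => m _.
by rewrite thetaZ theta_X mnm_consK.
Qed.

Lemma homogenize_dhomog d g :
  (msize g <= d.+1)%N -> homogenize d g \is d.-homog.
Proof.
move=> gd; rewrite homogenizeE big_seq; apply: rpred_sum => m m_supp.
(* The bound on [msize g] makes the truncated exponent [d - mdeg m] exact. *)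
apply: rpredZ; rewrite dhomogX /= mdeg_mnm_cons subnK //.
by rewrite -ltnS (leq_trans (msize_mdeg_lt m_supp)).
Qed.

Lemma theta_euler d p : p \is d.-homog ->
  theta p^`M(ord0) = theta p *+ d - \sum_(i < n) 'X_i * (theta p)^`M(i).
Proof.
move=> /dhomog_euler/(congr1 theta); rewrite rmorphMn => <-.
rewrite big_ord_recl rmorphD rmorphM theta_X.
have -> : mnm_tail U_(ord0) = 0%MM by apply/mnmP => i; rewrite !mnmE.
rewrite mpolyX0 mul1r; apply/esym/eqP; rewrite subr_eq; apply/eqP; congr (_ + _).
rewrite rmorph_sum; apply: eq_bigr => i _; rewrite rmorphM theta_X theta_mderiv; congr ('X_[_] * _).
by apply/mnmP => k; rewrite !mnmE (inj_eq lift_inj).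
Qed.

(** The formula of [phi] on arbitrary row vectors, so that it can be applied to a vector before that
    vector is known to be a syzygy. *)
Definition syzygy_dehomog d (a : 'rV[{mpoly K[n.+1]}]_n.+1) :
    'rV[{mpoly K[n]}]_n.+1 :=
  \row_(j < n.+1)
    if unlift ord0 j is Some i
    then theta (a 0 j) - 'X_i * theta (a 0 ord0)
    else d%:R * theta (a 0 ord0).

Lemma syzygy_dehomog_semilinear d c a b :
  syzygy_dehomog d (c *: a + b) =
  theta c *: syzygy_dehomog d a + syzygy_dehomog d b.
Proof.
apply/rowP => j; rewrite !mxE.
case: (unlift ord0 j) => [i|]; rewrite !rmorphD !rmorphM.
  by rewrite mulrDr mulrBr mulrCA opprD addrACA.
by rewrite mulrDr mulrCA.
Qed.

Lemma sum_syzygy_dehomog d p a : p \is d.-homog ->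
  \sum_(j < n.+1) syzygy_dehomog d a 0 j *
     (\row_(j < n.+1) if unlift ord0 j is Some i then (theta p)^`M(i)
                      else theta p) 0 j
  = theta (\sum_(j < n.+1) a 0 j * p^`M(j)).
Proof.
move=> hp; rewrite rmorph_sum !big_ord_recl !mxE unlift_none rmorphM.
rewrite (theta_euler hp) mulrBr -addrA; congr (_ + _).
  by rewrite -mulrA mulr_natl mulrnAr.
rewrite mulr_sumr -sumrN -big_split; apply: eq_bigr => i _.
by rewrite !mxE liftK mulrBl rmorphM theta_mderiv mulrA [_ * 'X_i]mulrC addrC.
Qed.

End Dehomogenization.

Theorem theorem2p7 (R : realType) (n d : nat)
  (g : {mpoly (complex R)[n]}) (f : {mpoly (complex R)[n.+1]})
  (g_deg : msize g = d.+1) (g_nonconst : (0 < d)%N)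
  (g_reduced : squarefree_mpoly g)
  (f_homog : is_homogenization d g f) :
  exists phi : {linear AR_proj f -> restrict_scalars (@theta _ n) (AR_aff g)},
    (forall a : AR_proj f,
       syzygy_val (phi a : AR_aff g) =
         \row_(j < n.+1)
           if unlift ord0 j is Some i
           then theta (a 0 j) - 'X_i * theta (a 0 ord0)
           else d%:R * theta (a 0 ord0)) /\
    (forall b : restrict_scalars (@theta _ n) (AR_aff g), exists a, phi a = b).
Proof.
have g_le : (msize g <= d.+1)%N by rewrite g_deg.
have fE := (is_homogenizationP f g_le).1 f_homog.
have f_dhomog : f \is d.-homog by rewrite fE homogenize_dhomog.
have gE : theta f = g by rewrite fE homogenizeK.
have sumE a := sum_syzygy_dehomog a f_dhomog.
rewrite gE in sumE.
have projE (a : 'rV_n.+1) : (a \in is_syzygy (\row_(j < n.+1) f^`M(j))) =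
    (\sum_(j < n.+1) a 0 j * f^`M(j) == 0).
  by rewrite unfold_in; under eq_bigr do rewrite mxE.
have phiP (a : AR_proj f) : syzygy_dehomog d a \in is_syzygy
    (\row_(j < n.+1) if unlift ord0 j is Some i then g^`M(i) else g).
  rewrite unfold_in sumE; have := syzygy_valP a.
  by rewrite projE => /eqP ->; rewrite rmorph0.
pose phi (a : AR_proj f) : restrict_scalars (@theta _ n) (AR_aff g) :=
  Syzygy (phiP a).
have phi_linear : linear phi.
  move=> c a b; apply: (@val_inj _ _ (AR_aff g)).
  exact: syzygy_dehomog_semilinear.
pose phi_mixin := GRing.isLinear.Build _ _ _ _ phi phi_linear.
pose phiL : {linear AR_proj f -> restrict_scalars (@theta _ n) (AR_aff g)} :=
  HB.pack phi phi_mixin.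
exists phiL; split=> // b.
have dR_neq0 : d%:R != 0 :> complex R.
  by rewrite Num.Theory.pnatr_eq0 -lt0n.
(* The preimage before homogenization: [b0] solves the equation for the coordinate [ord0], and
   [beta] then solves the others. *)
pose b0 := (d%:R^-1 : complex R) *: syzygy_val (b : AR_aff g) 0 ord0.
pose beta j := if unlift ord0 j is Some i
  then syzygy_val (b : AR_aff g) 0 j + 'X_i * b0 else b0.
(* One degree for all coordinates makes [\sum_j a_j f_j] homogeneous; surplus powers of [x_0] become
   1 under [theta]. *)
pose N := (\max_(j < n.+1) msize (beta j))%N.
pose a := \row_(j < n.+1) homogenize N (beta j).
have a_dehomog : syzygy_dehomog d a = syzygy_val (b : AR_aff g).
  apply/rowP => j; rewrite !mxE !homogenizeK /beta unlift_none.
  case: unliftP => [i ->|->]; first by rewrite addrK.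
  by rewrite mulr_natl -scaler_nat scalerA divff // scale1r.
have aP : a \in is_syzygy (\row_(j < n.+1) f^`M(j)).
  (* The identity [sumE] is now read backwards: the image under [theta] is the syzygy relation of
     [b], hence zero. *)
  rewrite projE; apply/eqP/(@dhomog_theta_eq0 _ _ (N + d.-1)).
    apply: rpred_sum => j _; rewrite dhomogM ?dhomog_mderiv // mxE.
    by rewrite homogenize_dhomog // ltnW // ltnS leq_bigmax.
  by rewrite -sumE a_dehomog; apply/eqP; exact: (syzygy_valP (b : AR_aff g)).
by exists (Syzygy aP); apply: val_inj.
Qed.
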